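(* For every even natural number $n \geq 8$, the upper orientable twin domination number of the complete graph $K_n$ satisfies $DOM^{*}(K_n) \leq \frac{n}{2}$.
   Context: Let $D=(V,A)$ be a digraph. A subset $S \subseteq V$ is a twin dominating set of $D$ if for every vertex $v \in V - S$ there exist vertices $u_1, u_2 \in S$ (possibly equal) such that $(v,u_1)$ and $(u_2,v)$ are arcs of $D$. The twin domination number $\gamma^{*}(D)$ is the minimum cardinality of a twin dominating set of $D$. For a graph $G$, the upper orientable twin domination number is $DOM^{*}(G)=\max\{\gamma^{*}(D) : D \text{ is an orientation of } G\}$. An orientation of $K_n$ is a tournament on $n$ vertices. *)

(* Defs.v *)
From mathcomp Require Import all_boot.

Set Implicit Arguments.
Unset Strict Implicit.
Unset Printing Implicit Defensive.

Record sgraph (V : finType) := SGraph {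
  edge :> rel V;
  edge_sym : symmetric edge;
  edge_irrefl : irreflexive edge
}.

Definition complete_rel (n : nat) : rel 'I_n := fun u v => u != v.

Lemma complete_sym n : symmetric (@complete_rel n).
Proof. by move=> u v; rewrite /complete_rel eq_sym. Qed.

Lemma complete_irrefl n : irreflexive (@complete_rel n).
Proof. by move=> u; rewrite /complete_rel eqxx. Qed.

Definition complete_graph (n : nat) : sgraph 'I_n :=
  SGraph (@complete_sym n) (@complete_irrefl n).

(* A digraph on V is given by its set of arcs A : {set V * V}. *)

Definition twin_dominating (V : finType) (A : {set V * V}) (S : {set V}) :=
  [forall v, (v \notin S) ==>
     [exists u1 in S, (v, u1) \in A] && [exists u2 in S, (u2, v) \in A]].

Lemma twin_dominating_setT (V : finType) (A : {set V * V}) :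
  twin_dominating A [set: V].
Proof. by apply/forallP => v; rewrite in_setT. Qed.

(* The minimum is over a nonempty family by twin_dominating_setT. *)
Definition twin_domination_number (V : finType) (A : {set V * V}) : nat :=
  #|[arg min_(S < [set: V] | twin_dominating A S) #|S|]|.

Definition is_orientation (V : finType) (G : sgraph V) (A : {set V * V}) :=
  [forall u, forall v,
     if G u v then ((u, v) \in A) (+) ((v, u) \in A) else (u, v) \notin A].

Lemma orientation_exists (V : finType) (G : sgraph V) :
  exists A : {set V * V}, is_orientation G A.
Proof.
exists [set p | G p.1 p.2 && (enum_rank p.1 < enum_rank p.2)].
apply/forallP => u; apply/forallP => v; rewrite !inE /= (edge_sym G v u).
case Guv: (G u v) => //=; case: (ltngtP (enum_rank u)) => // uv_rank.
by rewrite (enum_rank_inj (val_inj uv_rank)) edge_irrefl in Guv.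
Qed.

(* \max is 0 on an empty family, which orientation_exists excludes. *)
Definition DOM_star (V : finType) (G : sgraph V) : nat :=
  \max_(A : {set V * V} | is_orientation G A) twin_domination_number A.

(* Main.v *)
(* Grow a half-dominated vertex set two vertices at a time. Let S dominate X with
   |X| = 2|S| and let a -> b be new vertices. If neither S + a nor S + b dominates
   X + a + b, then a -> S -> b. If S + a + b - s also fails for every s in S, then
   each s is needed by some g(s) in R = X - S, as its only in-neighbour (with g(s)
   dominating a and b) or as its only out-neighbour (with a and b dominating g(s)),
   and g : S -> R is a bijection. When all the g(s) are of the first kind, R + b
   dominates. When g(i) -> g(k) are of the first kind and g(j) of the second,
   S - k + g(i) + g(j) dominates. Up to duality this leaves |S| = 2 with one vertex
   of each kind, where the only obstruction is the 6-vertex tournament made of a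
   3-cycle dominating another; for any further vertex x, swapping x with a suitable
   vertex of the dominating cycle gives a half-dominated 6-set. The growth starts
   from s -> {u, w} -> t, which every 8-vertex tournament contains. *)

Require Import Defs.
From mathcomp Require Import all_boot zify.

Set Implicit Arguments.
Unset Strict Implicit.
Unset Printing Implicit Defensive.

(** * Tournaments, arc reversal and half-dominated sets *)

Definition tournament (T : finType) (e : rel T) :=
  irreflexive e /\ forall x y, x != y -> e y x = ~~ e x y.

Definition dual (T : finType) (e : rel T) : rel T := fun x y => e y x.

Definition twin (T : finType) (e : rel T) (S : {set T}) (v : T) :=
  (exists2 u, u \in S & e v u) /\ (exists2 u, u \in S & e u v).

(** Domination is asked only inside [W], so this concerns the subtournament on [W]. The exact size
    is the invariant kept while [W] grows by two vertices. *)
Definition half_dominated (T : finType) (e : rel T) (W : {set T}) :=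
  exists S : {set T}, [/\ S \subset W, #|S|.*2 = #|W|
    & forall v, v \in W -> v \notin S -> twin e S v].

Lemma tournament_dual (T : finType) (e : rel T) :
  tournament e -> tournament (dual e).
Proof.
by move=> [e_irr e_tot]; split=> [x|x y x'y]; rewrite /dual // e_tot // eq_sym.
Qed.

Lemma half_dominated_dual (T : finType) (e : rel T) (W : {set T}) :
  half_dominated (dual e) W -> half_dominated e W.
Proof. by move=> [S [sub card dom]]; exists S; split=> // v vW /(dom v vW)[]. Qed.

Lemma arc_asym (T : finType) (e : rel T) x y :
  tournament e -> e x y -> e y x = false.
Proof.
move=> [e_irr e_tot] xy; rewrite e_tot ?xy //.
by apply: contraTneq xy => ->; rewrite e_irr.
Qed.

Lemma arc_neq (T : finType) (e : rel T) x y : tournament e -> e x y -> x != y.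
Proof. by move=> [e_irr _] xy; apply: contraTneq xy => ->; rewrite e_irr. Qed.

(** Turns explicit small configurations into boolean tests on lists, which rewriting with the known
    arcs settles. *)
Lemma half_dominated_seq (T : finType) (e : rel T) (W : {set T}) (w s : seq T) :
    W =i w -> uniq w -> uniq s -> (size s).*2 = size w ->
    all [in w] s ->
    all (fun v => (v \in s) || has (e v) s && has (e^~ v) s) w ->
  half_dominated e W.
Proof.
move=> Ww uniq_w uniq_s sizes sw /allP dom; exists [set x in s]; split.
- by apply/subsetP=> x; rewrite inE Ww => /(allP sw).
- by rewrite cardsE (card_uniqP uniq_s) (eq_card Ww) (card_uniqP uniq_w).
move=> v; rewrite Ww inE => /dom /orP[-> //|/andP[/hasP[x xs vx] /hasP[y ys yv]]] _.
by split; [exists x | exists y]; rewrite ?inE.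
Qed.

(** * Configurations blocking the simple extensions *)

(* This is how a vertex [v] fails to be dominated by [S + a + b - s] although [S]
   dominates it; the dual relation covers the vertices lacking an out-neighbour. *)
Definition attached (T : finType) (e : rel T) (S : {set T}) (a b s v : T) :=
  [/\ e v a, e v b, e s v & {in S, forall t, t != s -> e v t}].

(** [R] stands for the part of the dominated set outside [S], and [g s] for a vertex that
    [S + a + b - s] fails to dominate. *)
Record blocked (T : finType) (e : rel T) (S R : {set T}) (a b : T) (g : T -> T) :
  Prop := Blocked {
  blocked_tournament : tournament e;
  blocked_SR : [disjoint S & R];
  blocked_a : a \notin S :|: R;
  blocked_b : b \notin S :|: R;
  blocked_card : #|S| = #|R|;
  blocked_ab : e a b;
  blocked_aS : {in S, forall s, e a s};
  blocked_Sb : {in S, forall s, e s b};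
  blocked_img : R = g @: S;
  blocked_att : {in S, forall s,
    attached e S a b s (g s) \/ attached (dual e) S a b s (g s)} }.

Lemma attachedC (T : finType) (e : rel T) S a b s v :
  attached e S a b s v -> attached e S b a s v.
Proof. by case. Qed.

(** Reversing arcs turns a -> S -> b into b -> S -> a, so [a] and [b] trade places and the two kinds
    of [g s] are exchanged. *)
Lemma blocked_dual (T : finType) (e : rel T) S R a b g :
  blocked e S R a b g -> blocked (dual e) S R b a g.
Proof.
case=> tour SR aSR bSR card ab aS Sb img att; split=> //.
  exact: tournament_dual.
by move=> s /att[] /attachedC; [right | left].
Qed.

Lemma blocked_card2 (T : finType) (e : rel T) S R a b g :
  blocked e S R a b g -> #|a |: (b |: (S :|: R))| = (#|S|.+1).*2.
Proof.
case=> tour SR aSR bSR card ab _ _ _ _.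
rewrite cardsU1 in_setU1 (negPf aSR) (negPf (arc_neq tour ab)) /=.
rewrite cardsU1 bSR cardsU (disjoint_setI0 SR) cards0 -card; lia.
Qed.

(** The set R + b works: g(s) -> a -> b for any s, and g(t) -> v -> b for v in S and any t in S
    other than v; such a t exists as |S| > 1. *)
Lemma blocked_half_in (T : finType) (e : rel T) S R a b g :
    blocked e S R a b g -> 1 < #|S| ->
    {in S, forall s, attached e S a b s (g s)} ->
  half_dominated e (a |: (b |: (S :|: R))).
Proof.
move=> blk S_gt1 att; exists (b |: R); split.
- by rewrite subsetU // setUS ?orbT // subsetUr.
- rewrite (blocked_card2 blk) cardsU1 -(blocked_card blk).
  by move: (blocked_b blk); rewrite inE negb_or => /andP[_ ->].
case: blk => tour SR aSR bSR card ab aS Sb img _.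
have gR s : s \in S -> g s \in R by move=> sS; rewrite img imset_f.
have [s sS] : exists s, s \in S by apply/card_gt0P; lia.
move=> v; rewrite !inE negb_or => /or4P[/eqP->|/eqP->|vS|vR].
- move=> _; split; first by exists b; rewrite ?setU11.
  by exists (g s); [rewrite inE gR ?orbT | case: (att s sS)].
- by rewrite eqxx.
- move=> _; split; first by exists b; [rewrite setU11 | apply: Sb].
  have [t] : exists t, t \in S :\ v.
    by apply/card_gt0P; move: (cardsD1 v S); rewrite vS; lia.
  rewrite !inE => /andP[tv tS].
  exists (g t); first by rewrite inE gR ?orbT.
  by have [_ _ _] := att t tS; apply=> //; rewrite eq_sym.
- by rewrite vR andbF.
Qed.

Lemma blocked_half_mixed (T : finType) (e : rel T) S R a b g i k j :
    blocked e S R a b g -> i \in S -> k \in S -> j \in S -> e (g i) (g k) ->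
    attached e S a b i (g i) -> attached e S a b k (g k) ->
    attached (dual e) S a b j (g j) ->
  half_dominated e (a |: (b |: (S :|: R))).
Proof.
move=> blk iS kS jS gigk [ia ib igi giS] [ka kb kgk gkS] [ja jb jgj jS'].
have W_card := blocked_card2 blk.
case: blk => tour SR aSR bSR card ab aS Sb img att.
have gR s : s \in S -> g s \in R by move=> sS; rewrite img imset_f.
have gNS s : s \in S -> g s \notin S by move=> sS; rewrite (disjointFl SR) ?gR.
have ik : i != k by apply: contraTneq gigk => ->; rewrite tour.1.
have gjgi : g i != g j.
  by apply: contraTneq ia => ->; rewrite (arc_asym tour ja).
have jk : j != k.
  by apply: contraTneq ja => ->; rewrite /dual (arc_asym tour ka).
have ij : i != j by apply: contra_neq gjgi => ->.
(* Here g(i) -> a, b, k -> g(j), while g(i) -> g(k) -> i. Any other g(l) has l and i, both kept, as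
   its two neighbours. *)
pose S' := g i |: (g j |: (S :\ k)).
have S'i : g i \in S' by rewrite setU11.
have S'j : g j \in S' by rewrite !inE eqxx orbT.
have S'S s : s \in S -> s != k -> s \in S' by rewrite !inE => -> ->; rewrite !orbT.
exists S'; split.
- apply/subsetP=> v; rewrite !inE.
  by case/or3P=> [/eqP->|/eqP->|/andP[_ ->]]; rewrite ?gR ?orbT.
- rewrite W_card cardsU1 cardsU1 !inE (negPf gjgi) (negPf (gNS i iS)).
  by rewrite (negPf (gNS j jS)) !andbF (cardsD1 k S) kS.
move=> v; rewrite !inE => /or4P[/eqP->|/eqP->|vS vS'|].
- by split; [exists (g j)=> // | exists (g i)]; rewrite ?aS.
- by split; [exists (g j)=> // | exists (g i)]; rewrite ?aS.
- have {vS'} -> : v = k.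
    by apply/eqP; apply: contraR vS' => vk; rewrite vk vS !orbT.
  split; first by exists (g j) => //; apply: (jS' k); rewrite // eq_sym.
  by exists (g i) => //; apply: giS; rewrite // eq_sym.
rewrite img => /imsetP[l lS ->] {v} glS'.
have li : l != i by apply: contraNneq glS' => ->; rewrite eqxx.
have lj : l != j by apply: contraNneq glS' => ->; rewrite eqxx !orbT.
have [lk|lk] := eqVneq l k.
  by rewrite lk; split; [exists i | exists (g i)] => //; rewrite ?S'S ?gkS.
case: (att l lS) => -[_ _ lgl glS].
  split; last by exists l; rewrite ?S'S.
  by exists i; rewrite ?S'S ?glS // eq_sym.
split; first by exists l; rewrite ?S'S.
by exists i; rewrite ?S'S //; apply: glS; rewrite // eq_sym.
Qed.

Definition cyclic3 (T : finType) (e : rel T) x y z := [&& e x y, e y z & e z x].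

(* The tournament on six vertices in which one 3-cycle dominates another; it is the
   only one of order six that is not half-dominated. *)
Definition double_cycle (T : finType) (e : rel T) (W : {set T}) :=
  exists p0 p1 p2 q0 q1 q2, [/\ W =i [:: p0; p1; p2; q0; q1; q2],
    uniq [:: p0; p1; p2; q0; q1; q2], cyclic3 e p0 p1 p2, cyclic3 e q0 q1 q2 &
    forall p q, p \in [:: p0; p1; p2] -> q \in [:: q0; q1; q2] -> e p q].

(** The 3-cycles a -> i -> g(i) -> a and b -> g(j) -> j -> b are forced, as are seven of the nine
    arcs from the first to the second. Only the arcs between i and j and between g(i) and g(j) are
    free, and reversing either one yields a dominating triple. *)
Lemma blocked_pair (T : finType) (e : rel T) S R a b g i j :
    blocked e S R a b g -> S = [set i; j] -> i != j ->
    attached e S a b i (g i) -> attached (dual e) S a b j (g j) ->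
  half_dominated e (a |: (b |: (S :|: R))) \/
  double_cycle e (a |: (b |: (S :|: R))).
Proof.
move=> blk Sij ij [ia ib igi giS] [ja jb jgj jS'].
have [iS jS] : i \in S /\ j \in S by rewrite Sij !inE !eqxx orbT.
have {giS} gij : e (g i) j by apply: giS; rewrite // eq_sym.
have {jS'} igj : e i (g j) by apply: (jS' i).
rewrite /dual in ja jb jgj.
case: blk => tour SR aSR bSR card ab aS Sb img att.
have [ai aj bi bj] := And4 (aS i iS) (aS j jS) (Sb i iS) (Sb j jS).
have gij' : g i != g j.
  by apply: contraTneq ia => ->; rewrite (arc_asym tour ja).
set W := a |: _.
have Ww : W =i [:: a; i; g i; b; g j; j].
  move=> v; rewrite /W img Sij imsetU1 imset_set1 !inE.
  by case: (v == a); case: (v == b); case: (v == i); case: (v == j);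
    case: (v == g i); case: (v == g j).
have uniq_w : uniq [:: a; i; g i; b; g j; j].
  rewrite /= !inE !negb_or ij gij' (arc_neq tour ab) (arc_neq tour ai).
  rewrite (arc_neq tour aj) (arc_neq tour ja) (eq_sym a) (arc_neq tour ia).
  rewrite (arc_neq tour igi) (arc_neq tour bi) (arc_neq tour igj).
  rewrite (arc_neq tour ib) (arc_neq tour gij) (arc_neq tour jb).
  by rewrite (eq_sym b) (arc_neq tour bj) (arc_neq tour jgj).
have arcs := (ab, ia, ib, ja, jb, ai, aj, bi, bj, igi, jgj, gij, igj).
have half s : uniq s -> size s = 3 -> all [in [:: a; i; g i; b; g j; j]] s ->
    all (fun v => (v \in s) || has (e v) s && has (e^~ v) s)
      [:: a; i; g i; b; g j; j] -> half_dominated e W.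
  by move=> us ss; apply: (half_dominated_seq Ww uniq_w us); rewrite ss.
have [ji|] := boolP (e j i).
  left; apply: (half [:: g i; b; j]) => //.
  - exact: (mask_uniq uniq_w [:: false; false; true; true; false; true]).
  - by rewrite /= !inE !eqxx !orbT.
  by rewrite /= !inE !eqxx !arcs ji !orbT.
rewrite -tour.2 1?eq_sym // => {}ij.
have [gji|] := boolP (e (g j) (g i)).
  left; apply: (half [:: a; g i; b]) => //.
  - exact: (mask_uniq uniq_w [:: true; false; true; true]).
  - by rewrite /= !inE !eqxx !orbT.
  by rewrite /= !inE !eqxx !arcs gji !orbT.
rewrite -tour.2 1?eq_sym // => gigj; right.
exists a, i, (g i), b, (g j), j; split=> //.
- by rewrite /cyclic3 ai igi ia.
- by rewrite /cyclic3 jb jgj bj.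
by move=> p q; rewrite !inE => /or3P[]/eqP-> /or3P[]/eqP->.
Qed.

(** Whichever way the arc between g(i) and g(k) points, [blocked_half_mixed] applies, up to
    exchanging i and k. *)
Lemma blocked_half_two (T : finType) (e : rel T) S R a b g i k j :
    blocked e S R a b g -> i \in S -> k \in S -> j \in S -> i != k ->
    attached e S a b i (g i) -> attached e S a b k (g k) ->
    attached (dual e) S a b j (g j) ->
  half_dominated e (a |: (b |: (S :|: R))).
Proof.
move=> blk iS kS jS ik ia ka ja.
have tour := blocked_tournament blk.
have gik : g i != g k.
  apply: contraNneq ik => gik; have [//|ik] := eqVneq i k.
  case: ka => _ _ kgk _; case: ia => _ _ _ /(_ k kS).
  by rewrite gik (arc_asym tour kgk) eq_sym => /(_ ik).
have [gigk|] := boolP (e (g i) (g k)).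
  exact: (blocked_half_mixed blk iS kS jS gigk).
rewrite -tour.2 // => gkgi.
exact: (blocked_half_mixed blk kS iS jS gkgi).
Qed.

Lemma blocked_half (T : finType) (e : rel T) S R a b g :
    blocked e S R a b g -> 1 < #|S| ->
  half_dominated e (a |: (b |: (S :|: R))) \/
    #|S| = 2 /\ double_cycle e (a |: (b |: (S :|: R))).
Proof.
move=> blk S_gt1.
have tour := blocked_tournament blk.
(* The arc between [g s] and [a] tells the two kinds apart: it enters [a] for the first and leaves
   [a] for the second. *)
pose I := [set s in S | e (g s) a]; pose J := S :\: I.
have inI s : s \in I -> s \in S /\ attached e S a b s (g s).
  rewrite inE => /andP[sS ga]; split=> //.
  by have [//|[ag _ _ _]] := blocked_att blk sS; rewrite (arc_asym tour ag) in ga.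
have inJ s : s \in J -> s \in S /\ attached (dual e) S a b s (g s).
  rewrite !inE => /andP[nga sS]; rewrite sS /= in nga; split=> //.
  by have [[ga _ _ _]|//] := blocked_att blk sS; rewrite ga in nga.
have IS : I \subset S by apply/subsetP=> s /inI[].
have cardIJ : #|I| + #|J| = #|S| by rewrite cardsD (setIidPr IS) subnKC ?subset_leq_card.
have blk' := blocked_dual blk.
have WC : a |: (b |: (S :|: R)) = b |: (a |: (S :|: R)) by rewrite setUCA.
have inJ' s : s \in J -> s \in S /\ attached (dual e) S b a s (g s).
  by move=> /inJ[? /attachedC].
have [J0|/set0Pn[j jJ]] := eqVneq J set0.
  left; apply: (blocked_half_in blk) => // s sS; apply: (inI s _).2.
  by move: (in_set0 s); rewrite -J0 in_setD sS andbT => /negbFE.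
have [I0|/set0Pn[i iI]] := eqVneq I set0.
  left; rewrite WC; apply: half_dominated_dual.
  apply: (blocked_half_in blk') => // s sS; apply: (inJ' s _).2.
  by rewrite /J I0 setD0.
have [iS ia] := inI _ iI; have [jS ja] := inJ _ jJ.
have [/card_gt1P[i1 [i2 [/inI[i1S i1a] /inI[i2S i2a] i12]]]|I_le1] := ltnP 1 #|I|.
  by left; apply: (blocked_half_two blk i1S i2S jS i12).
have [/card_gt1P[i1 [i2 [/inJ'[i1S i1a] /inJ'[i2S i2a] i12]]]|J_le1] := ltnP 1 #|J|.
  left; rewrite WC; apply: half_dominated_dual.
  by apply: (blocked_half_two blk' i1S i2S iS i12 i1a i2a (attachedC ia)).
have ij : i != j by apply: contraTneq jJ => <-; rewrite in_setD iI.
have S2 : #|S| = 2 by apply/eqP; rewrite eqn_leq S_gt1 -cardIJ (leq_add I_le1 J_le1).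
have Sij : S = [set i; j].
  by apply/esym/eqP; rewrite eqEcard S2 cards2 ij subUset !sub1set iS jS.
have [half|cyc] := blocked_pair blk Sij ij ia ja; first by left.
by right.
Qed.

(** * Adding two vertices to a half-dominated set *)

Lemma twinP (T : finType) (e : rel T) (S : {set T}) (v : T) :
  reflect (twin e S v) ([exists u in S, e v u] && [exists u in S, e u v]).
Proof. by apply: (iffP andP) => -[/exists_inP ? /exists_inP ?]. Qed.

Lemma twinS (T : finType) (e : rel T) (S S' : {set T}) (v : T) :
  S \subset S' -> twin e S v -> twin e S' v.
Proof.
move=> /subsetP SS' [[u /SS' uS vu] [w /SS' wS wv]].
by split; [exists u | exists w].
Qed.

Lemma half_dominated_add (T : finType) (e : rel T) (X S : {set T}) (a b : T) :
    S \subset X -> #|S|.*2 = #|X| ->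
    (forall v, v \in X -> v \notin S -> twin e S v) ->
    a != b -> a \notin X -> b \notin X -> twin e (a |: S) b ->
  half_dominated e (a |: (b |: X)).
Proof.
move=> SX cardS dom ab aX bX twb; exists (a |: S); split.
- by rewrite setUS // subsetU // SX orbT.
- rewrite !cardsU1 in_setU1 (negPf ab) (negPf aX) bX -cardS.
  by rewrite (contra (subsetP SX a)).
move=> v; rewrite in_setU1 in_setU1 => /or3P[/eqP->|/eqP-> //|vX].
  by rewrite setU11.
rewrite in_setU1 negb_or => /andP[_ vS].
by apply: twinS (dom v vX vS); apply: subsetUr.
Qed.

(** With no in-neighbour in S + a + b - s, [v] beats all of that set, so its in-neighbour [u] in [S]
    can only be [s]. *)
Lemma attachedP (T : finType) (e : rel T) (S : {set T}) (a b s v u : T) :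
    tournament e -> v \notin a |: (b |: S) ->
    {in a |: (b |: (S :\ s)), forall t, ~~ e t v} -> u \in S -> e u v ->
  attached e S a b s v.
Proof.
move=> tour; rewrite !inE !negb_or => /and3P[va vb vS] none uS uv.
have arc t : t \in a |: (b |: (S :\ s)) -> v != t -> e v t.
  by move=> tS' vt; rewrite tour.2 1?eq_sym // none.
split.
- by apply: arc; rewrite // setU11.
- by apply: arc; rewrite // !inE eqxx orbT.
- have [<- //|us] := eqVneq u s.
  by have := none u; rewrite !inE us uS uv !orbT => /(_ isT).
move=> t tS ts; apply: arc; first by rewrite !inE tS ts !orbT.
by apply: contraNneq vS => ->.
Qed.

Lemma half_dominated_extend (T : finType) (e : rel T) (X : {set T}) (a b : T) :
    tournament e -> half_dominated e X -> 3 < #|X| ->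
    a != b -> a \notin X -> b \notin X ->
  half_dominated e (a |: (b |: X)) \/
    #|X| = 4 /\ double_cycle e (a |: (b |: X)).
Proof.
move=> tour [S [SX cardS dom]] X_gt3.
wlog ab : a b / e a b => [hwlog|] a'b aX bX.
  have [ab|] := boolP (e a b); first exact: hwlog.
  rewrite -tour.2 // => ba; rewrite setUCA.
  by apply: hwlog; rewrite 1?eq_sym.
have [/twinP twb|Ntwb] := boolP ([exists u in a |: S, e b u] && [exists u in a |: S, e u b]).
  by left; apply: (half_dominated_add SX).
have [/twinP twa|Ntwa] := boolP ([exists u in b |: S, e a u] && [exists u in b |: S, e u a]).
  by left; rewrite setUCA; apply: (half_dominated_add SX); rewrite // eq_sym.
(* An arc s -> a, together with a -> b, would make S + b dominate [a]. *)
have aS s : s \in S -> e a s.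
  move=> sS; rewrite tour.2; last by apply: contraNneq aX => <-; apply: (subsetP SX).
  apply: contra Ntwa => sa; apply/twinP; split.
    by exists b; rewrite ?setU11.
  by exists s; rewrite // inE sS orbT.
have Sb s : s \in S -> e s b.
  move=> sS; rewrite tour.2; last by apply: contraNneq bX => ->; apply: (subsetP SX).
  apply: contra Ntwb => bs; apply/twinP; split.
    by exists s; rewrite // inE sS orbT.
  by exists a; rewrite ?setU11.
pose R := X :\: S.
have XSR : X = S :|: R by rewrite -(setID X S) (setIidPr SX).
have cardR : #|R| = #|S| by rewrite cardsD (setIidPr SX) -cardS -addnn addnK.
pose S' s := a |: (b |: (S :\ s)).
pose lost s := [pick v in R | ~~ ([exists u in S' s, e v u] && [exists u in S' s, e u v])].
have [/exists_inP[s sS /eqP none]|] := boolP [exists s in S, lost s == None].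
  left; exists (S' s); split.
  - by rewrite !setUS // (subset_trans _ SX) // subsetDl.
  - rewrite !cardsU1 !in_setU1 (negPf a'b) (negPf aX) bX in_setD1.
    rewrite !(contraNF (subsetP SX _)) // andbF -cardS.
    by rewrite in_setD1 (contraNF (subsetP SX b)) // andbF (cardsD1 s S) sS.
  move=> v; rewrite in_setU1 in_setU1 => /or3P[/eqP->|/eqP->|vX vS'].
  - by rewrite setU11.
  - by rewrite !inE eqxx orbT.
  (* The removed vertex is always dominated, since a -> s -> b; only vertices of [R] can be lost. *)
  have [vs|vs] := eqVneq v s.
    rewrite vs; split; first by exists b; rewrite ?Sb // !inE eqxx orbT.
    by exists a; rewrite ?aS ?setU11.
  move: none; rewrite /lost; case: pickP => // none _; apply/twinP.
  have := none v; rewrite inE vX andbT => /negbT; rewrite negb_and negbK.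
  case/orP=> [vS|/negbNE //].
  by rewrite !inE vs vS !orbT in vS'.
rewrite negb_exists_in => /forall_inP some_lost.
(* The default is never reached on [S], where [lost s] is not [None]. *)
pose g s := odflt s (lost s).
have gP s : s \in S -> g s \in R /\
    ~~ ([exists u in S' s, e (g s) u] && [exists u in S' s, e u (g s)]).
  move=> sS; have := some_lost s sS; rewrite /g /lost.
  by case: pickP => [v /andP[vR Ntw] _|//].
have att s : s \in S -> attached e S a b s (g s) \/ attached (dual e) S a b s (g s).
  move=> sS; have [] := gP s sS; set v := g s => vR Ntw.
  have [vS vX] : v \notin S /\ v \in X by move: vR; rewrite inE => /andP[].
  have vabS : v \notin a |: (b |: S).
    rewrite !inE !negb_or vS andbT.
    by rewrite !(contraTneq _ vX) // => ->.
  have [[w wS vw] [u uS uv]] := dom v vX vS.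
  have [none|] := boolP [forall t in S' s, ~~ e t v].
    by left; apply: (attachedP tour vabS _ uS uv); apply/forall_inP.
  rewrite negb_forall_in => /exists_inP[t tS' /negbNE tv].
  right; apply: (attachedP (tournament_dual tour) vabS _ wS vw) => z zS'.
  apply: contra Ntw => vz; apply/twinP.
  by split; [exists z | exists t].
(* If g(s) = g(t) with s != t, equal kinds disagree on the arc between this vertex and t, and
   different kinds on its arc with [a]. *)
have g_inj : {in S &, injective g}.
  move=> s t sS tS gst; apply/eqP; apply: contraT => st.
  have ts : t != s by rewrite eq_sym.
  case: (att s sS) => -[sa _ _ sS']; case: (att t tS) => -[ta _ tgt _].
  - by have := sS' t tS ts; rewrite gst (arc_asym tour tgt).
  - by rewrite gst /dual in sa ta; rewrite (arc_asym tour ta) in sa.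
  - by rewrite gst /dual in sa ta; rewrite (arc_asym tour ta) in sa.
  by have := sS' t tS ts; rewrite gst /dual (arc_asym tour tgt).
have blk : blocked e S R a b g.
  split=> //; rewrite -?XSR //.
    by rewrite -setI_eq0 setIDA setIC setDIl setDv setI0.
  apply/esym/eqP; rewrite eqEcard card_in_imset // cardR leqnn andbT.
  by apply/subsetP=> _ /imsetP[s /gP[gR _] ->].
have S_gt1 : 1 < #|S| by rewrite -leq_double cardS.
have := blocked_half blk S_gt1; rewrite -XSR -cardS.
by case=> [|[->]]; [left | right].
Qed.

(** * Escaping the double 3-cycle *)

(** Here [x] replaces the third vertex of the dominating cycle. If x -> a then x -> a' too, and {q0,
    q1, x} dominates. If a -> x -> q for some q in the q-cycle, [a], q and the predecessor or
    successor of q dominate. Otherwise the q-cycle beats [x], and {a, q0, x} dominates. *)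
Lemma double_cycle_swap (T : finType) (e : rel T) a a' x q0 q1 q2 :
    tournament e -> uniq [:: a; a'; q0; q1; q2; x] ->
    e a a' -> ~~ (e a' x && e x a) -> cyclic3 e q0 q1 q2 ->
    {in [:: q0; q1; q2], forall q, e a q && e a' q} ->
  exists W : {set T}, #|W| = 6 /\ half_dominated e W.
Proof.
move=> tour uniq_w aa' not_aa'x cyc dom.
exists [set z in [:: a; a'; q0; q1; q2; x]]; split.
  by rewrite cardsE (card_uniqP uniq_w).
have Ww : [set z in [:: a; a'; q0; q1; q2; x]] =i [:: a; a'; q0; q1; q2; x].
  by move=> v; rewrite in_set.
have half m := half_dominated_seq (e := e) Ww uniq_w (mask_uniq uniq_w m).
have [/andP[a0 a'0] /andP[a1 a'1] /andP[a2 a'2]] :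
    [/\ e a q0 && e a' q0, e a q1 && e a' q1 & e a q2 && e a' q2].
  by split; apply: dom; rewrite !inE eqxx ?orbT.
have /and3P[q01 q12 q20] := cyc.
have arcs := (aa', a0, a1, a2, a'0, a'1, a'2, q01, q12, q20).
have x_arc v : v \in [:: a; a'; q0; q1; q2] -> ~~ e x v = e v x.
  move=> vw; rewrite -tour.2 //; apply: contraTneq uniq_w => xv.
  by rewrite -xv in vw; rewrite -[_ :: _]/(rcons [:: a; a'; q0; q1; q2] x)
    rcons_uniq vw.
have [xa|] := boolP (e x a).
  have xa' : e x a'.
    by apply: contraNT not_aa'x => xa'; rewrite xa -x_arc ?xa' // !inE eqxx orbT.
  apply: (half [:: false; false; true; true; false; true]) => //.
    by rewrite /= !inE !eqxx !orbT.
  by rewrite /= !inE !eqxx !arcs xa xa' !orbT.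
rewrite x_arc ?inE ?eqxx // => ax.
have [x0|Nx0] := boolP (e x q0).
  apply: (half [:: true; false; true; true; false; false]) => //.
    by rewrite /= !inE !eqxx !orbT.
  by rewrite /= !inE !eqxx !arcs ax x0 !orbT.
have [x1|Nx1] := boolP (e x q1).
  apply: (half [:: true; false; false; true; true; false]) => //.
    by rewrite /= !inE !eqxx !orbT.
  by rewrite /= !inE !eqxx !arcs ax x1 !orbT.
have [x2|Nx2] := boolP (e x q2).
  apply: (half [:: true; false; true; false; true; false]) => //.
    by rewrite /= !inE !eqxx !orbT.
  by rewrite /= !inE !eqxx !arcs ax x2 !orbT.
apply: (half [:: true; false; true; false; false; true]) => //.
  by rewrite /= !inE !eqxx !orbT.
rewrite !x_arc ?inE ?eqxx ?orbT // in Nx0 Nx1 Nx2.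
by rewrite /= !inE !eqxx !arcs ax Nx0 Nx1 Nx2 !orbT.
Qed.

Lemma double_cycle_outside (T : finType) (e : rel T) (W : {set T}) (x : T) :
    tournament e -> double_cycle e W -> x \notin W ->
  exists W : {set T}, #|W| = 6 /\ half_dominated e W.
Proof.
move=> tour [p0 [p1 [p2 [q0 [q1 [q2 [Ww uniq_w]]]]]]].
move=> /and3P[p01 p12 p20] cyc dom; rewrite Ww => xw.
have uniq_x : uniq [:: p0; p1; p2; q0; q1; q2; x].
  by rewrite -[_ :: _]/(rcons [:: p0; p1; p2; q0; q1; q2] x) rcons_uniq xw.
have dom2 p p' : p \in [:: p0; p1; p2] -> p' \in [:: p0; p1; p2] ->
    {in [:: q0; q1; q2], forall q, e p q && e p' q}.
  by move=> ? ? q ?; rewrite !dom.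
(* The arcs p0 -> p1 and p1 -> p2 cannot both close a 3-cycle with [x]: the first needs p1 -> x, the
   second x -> p1. *)
have [c01|c01] := boolP (e p1 x && e x p0); last first.
  apply: (double_cycle_swap tour _ p01 c01 cyc); last first.
    by apply: dom2; rewrite !inE eqxx ?orbT.
  exact: (mask_uniq uniq_x [:: true; true; false; true; true; true; true]).
have [c12|c12] := boolP (e p2 x && e x p1); last first.
  apply: (double_cycle_swap tour _ p12 c12 cyc); last first.
    by apply: dom2; rewrite !inE eqxx ?orbT.
  exact: (mask_uniq uniq_x [:: false; true; true; true; true; true; true]).
case/andP: c01 => p1x _; case/andP: c12 => _.
by rewrite (arc_asym tour p1x).
Qed.

(** * Finding a half-dominated 6-set *)

(** Take y among the out-neighbours N of [x]. Two in-neighbours of y in N give a diamond from [x] to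
    y. Otherwise y has two out-neighbours in N, and the one beaten by the other is the sink. *)
Lemma out4_diamond (T : finType) (e : rel T) (x : T) :
    tournament e -> 3 < #|[set y | e x y]| ->
  exists s t u w, [/\ u != w, e s u, e s w, e u t & e w t].
Proof.
move=> tour; set N := [set y | e x y] => N_gt3.
have [y yN] : exists y, y \in N by apply/card_gt0P; apply: leq_trans N_gt3.
have [/card_gt1P[u [w []]]|le1] := ltnP 1 #|[set z in N | e z y]|.
  by rewrite !inE => /andP[xu uy] /andP[xw wy] uw; exists x, y, u, w.
have : 1 < #|[set z in N | e y z]|.
  have sub : N :\ y \subset [set z in N | e z y] :|: [set z in N | e y z].
    apply/subsetP=> z; rewrite !inE => /andP[zy ->] /=.
    by rewrite (tour.2 z y) // orbN.
  move: N_gt3; rewrite (cardsD1 y) yN /= add1n ltnS => N_gt2.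
  have := leq_trans N_gt2 (leq_trans (subset_leq_card sub) (leq_card_setU _ _)).
  by move=> lt2; have := leq_trans lt2 (leq_add le1 (leqnn _)).
case/card_gt1P=> u [w []]; rewrite !inE => /andP[xu yu] /andP[xw yw] uw.
have xy : e x y by rewrite inE in yN.
have [uw'|] := boolP (e u w).
  by exists x, w, y, u; rewrite (arc_neq tour yu).
rewrite -tour.2 // => wu.
by exists x, u, y, w; rewrite (arc_neq tour yw).
Qed.

(** A vertex with at least 7 neighbours has out-degree or in-degree at least 4, and reversing all
    arcs of a diamond just swaps [s] and [t]. *)
Lemma diamond (T : finType) (e : rel T) : tournament e -> 7 < #|T| ->
  exists s t u w, [/\ u != w, e s u, e s w, e u t & e w t].
Proof.
move=> tour T_gt7.
have [x _] : exists x, x \in T by apply/card_gt0P; apply: leq_trans T_gt7.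
have [|out_le3] := ltnP 3 #|[set y | e x y]|; first exact: out4_diamond.
have : 3 < #|[set y | dual e x y]|.
  have sub : ~: [set x] \subset [set y | e x y] :|: [set y | dual e x y].
    apply/subsetP=> z; rewrite !inE => zx.
    by rewrite /dual (tour.2 x z) 1?eq_sym // orbN.
  have := leq_trans (subset_leq_card sub) (leq_card_setU _ _).
  move: T_gt7; rewrite -(cardsC [set x]) cards1 add1n ltnS => lt7 le.
  have := leq_trans lt7 (leq_trans le (leq_add out_le3 (leqnn _))).
  by rewrite -[7]/(3 + 4) leq_add2l.
case/out4_diamond=> [|s [t [u [w [uw su sw ut wt]]]]].
  exact: tournament_dual.
by exists t, s, u, w.
Qed.

Lemma half_dominated6 (T : finType) (e : rel T) : tournament e -> 7 < #|T| ->
  exists W : {set T}, #|W| = 6 /\ half_dominated e W.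
Proof.
move=> tour T_gt7; have [s [t [u [w [uw su sw ut wt]]]]] := diamond tour T_gt7.
pose X := [set z in [:: s; u; w; t]].
have uniq_X : uniq [:: s; u; w; t].
  rewrite /= !inE !negb_or uw (arc_neq tour su) (arc_neq tour sw).
  rewrite (arc_neq tour ut) (arc_neq tour wt) !andbT /=.
  by apply: contraTneq ut => <-; rewrite (arc_asym tour su).
have cardX : #|X| = 4 by rewrite cardsE (card_uniqP uniq_X).
have halfX : half_dominated e X.
  apply: (half_dominated_seq _ uniq_X (s := [:: s; t])) => //.
  - by move=> v; rewrite in_set.
  - exact: (mask_uniq uniq_X [:: true; false; false; true]).
  - by rewrite /= !inE !eqxx !orbT.
  by rewrite /= !inE !eqxx su sw ut wt !orbT.
have /card_gt1P[a [b [aX bX ab]]] : 1 < #|~: X|.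
  by move: T_gt7; rewrite -(cardsC X) cardX; case: #|_| => [|[|?]].
rewrite in_setC in aX; rewrite in_setC in bX.
have card6 : #|a |: (b |: X)| = 6.
  by rewrite !cardsU1 in_setU1 (negPf ab) (negPf aX) bX cardX.
have [|half|[_ cyc]] := half_dominated_extend tour halfX _ ab aX bX.
- by rewrite cardX.
- by exists (a |: (b |: X)).
have /card_gt0P[x] : 0 < #|~: (a |: (b |: X))|.
  by move: T_gt7; rewrite -(cardsC (a |: (b |: X))) card6; case: #|_|.
rewrite in_setC; exact: (double_cycle_outside tour cyc).
Qed.

(** * Growth to the whole vertex set and the bound *)

(** Induction on the number [k] of pairs still outside [W]. The double 3-cycle arises only when a
    4-set is extended, which |W| > 4 excludes. *)
Lemma half_dominated_grow (T : finType) (e : rel T) (W : {set T}) (k : nat) :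
    tournament e -> half_dominated e W -> 4 < #|W| -> #|W| + k.*2 = #|T| ->
  half_dominated e [set: T].
Proof.
move=> tour; elim: k W => [|k IHk] W halfW W_gt4 cardT.
  have <- // : W = [set: T].
  by apply/eqP; rewrite eqEcard subsetT cardsT -cardT double0 addn0 leqnn.
have /card_gt1P[a [b [aW bW ab]]] : 1 < #|~: W|.
  by move: cardT; rewrite -(cardsC W) => /addnI <-.
rewrite in_setC in aW; rewrite in_setC in bW.
have [|half|[W4 _]] := half_dominated_extend tour halfW _ ab aW bW.
- exact: ltnW.
- have cardW : #|a |: (b |: W)| = #|W|.+2.
    by rewrite !cardsU1 in_setU1 (negPf ab) (negPf aW) bW.
  apply: (IHk (a |: (b |: W))) => //; first by rewrite cardW; do 2!apply: leqW.
  by rewrite cardW -cardT doubleS !addnS.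
by rewrite W4 in W_gt4.
Qed.

Lemma half_dominatedT (T : finType) (e : rel T) :
  tournament e -> ~~ odd #|T| -> 7 < #|T| -> half_dominated e [set: T].
Proof.
move=> tour T_even T_gt7; have [W [W6 halfW]] := half_dominated6 tour T_gt7.
(* The starting 6-set accounts for three of the |T|/2 pairs. *)
apply: (half_dominated_grow (k := #|T|./2 - 3) tour halfW); rewrite W6 //.
rewrite doubleB -[6]/(3.*2) subnKC; last by rewrite leq_double; lia.
by rewrite -[RHS]odd_double_half (negPf T_even).
Qed.

Lemma orientation_complete_tournament (n : nat) (A : {set 'I_n * 'I_n}) :
  is_orientation (complete_graph n) A -> tournament (fun u v => (u, v) \in A).
Proof.
move=> /forallP orA; split=> [x|x y xy].
  by apply/negbTE; move: (orA x) => /forallP/(_ x); rewrite /= /complete_rel eqxx.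
by move: (orA x) => /forallP/(_ y); rewrite /= /complete_rel xy; do 2!case: (_ \in A).
Qed.

Theorem theorem3p1 (n : nat) (n_even : ~~ odd n) (n_ge8 : 8 <= n) :
  DOM_star (complete_graph n) <= n./2.
Proof.
apply/bigmax_leqP=> A /orientation_complete_tournament tour.
have [||S [_ cardS dom]] := half_dominatedT tour; rewrite ?card_ord //.
have SA : twin_dominating A S.
  by apply/forallP=> v; apply/implyP=> vS; apply/(twinP (fun x y => (x, y) \in A)); apply: dom.
rewrite /twin_domination_number; case: arg_minnP => [|S' _ min_S'].
  exact: twin_dominating_setT.
by apply: leq_trans (min_S' S SA) _; rewrite -leq_double cardS cardsT card_ord
  -[leqRHS]add0n -{1}(odd_double_half n) (negPf n_even).
Qed.
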